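(* Let $V$ and $W$ be matrix regular operator spaces, and let $V\otimes_\alpha W$ denote the algebraic tensor product $V\otimes W$ (with its natural involution) equipped with matrix norms $\|\cdot\|_\alpha$ and matrix cones $M_n(V\otimes_\alpha W)^+$ making it a matrix regular operator space. (1) If $\|\cdot\|_\alpha$ is a subcross matrix norm (that is, $\|v\otimes w\|_\alpha\le\|v\|\,\|w\|$ for all $k,l\in\mathbb N$, $v\in M_k(V)$, $w\in M_l(W)$) and $v\otimes w\in M_{kl}(V\otimes_\alpha W)^+$ for all $k,l\in\mathbb N$, $v\in M_k(V)^+$, $w\in M_l(W)^+$, then for every $n\in\mathbb N$ $$M_n(V\otimes_\Delta W)^+\subset M_n(V\otimes_\alpha W)^+\quad\text{and}\quad \|\cdot\|_\alpha\le\|\cdot\|_\Delta \text{ on } M_n(V\otimes W).$$ (2) If $\varphi\otimes\psi:V\otimes_\alpha W\to M_{kl}$ is c.c.p. for all $k,l\in\mathbb N$ and all c.c.p. maps $\varphi:V\to M_k$, $\psi:W\to M_l$, then for every $n\in\mathbb N$ $$M_n(V\otimes_\alpha W)^+\subset M_n(V\otimes_\delta W)^+\quad\text{and}\quad \|\cdot\|_\delta\le\|\cdot\|_\alpha \text{ on } M_n(V\otimes W).$$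
   Context: Spaces are complex; operator spaces (in Ruan's abstract sense) are not assumed complete. A $*$-vector space $V$ (so $M_n(V)$ has $[v_{ij}]^*=[v_{ji}^*]$) is matrix ordered if each $M_n(V)$ is given a (not necessarily proper) cone $M_n(V)^+\subset M_n(V)_{sa}$ and $\alpha^*M_m(V)^+\alpha\subset M_n(V)^+$ for all $\alpha\in M_{m,n}$ (scalar matrices). A matrix ordered operator space is an operator space that is matrix ordered such that, for all $n$, $*$ is isometric on $M_n(V)$ and $M_n(V)^+$ is closed. It is matrix regular if for all $n$ and $v\in M_n(V)_{sa}$: (i) $u\in M_n(V)^+$ and $-u\le v\le u$ imply $\|v\|\le\|u\|$; (ii) $\|v\|<1$ implies there is $u\in M_n(V)^+$ with $\|u\|<1$ and $-u\le v\le u$. Equivalently: for all $n$ and $x\in M_n(V)$, $\|x\|<1$ iff there are $a,d\in M_n(V)^+$ with $\|a\|,\|d\|<1$ and $\begin{pmatrix} a & x \\ x^* & d \end{pmatrix}\in M_{2n}(V)^+$. A linear map $\varphi:V\to W$ has amplifications $\varphi_n([v_{ij}])=[\varphi(v_{ij})]$; it is c.p. (completely positive) if $\varphi_n(M_n(V)^+)\subset M_n(W)^+$ for all $n$, and c.c.p. if c.p. and completely contractive. $V\otimes W$ is the algebraic tensor product with $(v\otimes w)^*=v^*\otimes w^*$; for $v=[v_{ij}]\in M_k(V)$, $w=[w_{pq}]\in M_l(W)$, $v\otimes w\in M_{kl}(V\otimes W)$ is the matrix $[v_{ij}\otimes w_{pq}]$. $\Delta$-structure: $M_n(V\otimes_\Delta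 W)_+=\{\alpha(v\otimes w)\alpha^*: v\in M_k(V)^+, w\in M_l(W)^+, \alpha\in M_{n,kl}, k,l\in\mathbb N\}$; for $z$ in this set, $|z|_\Delta=\inf\{\|\alpha\|^2\|v\|\|w\|: z=\alpha(v\otimes w)\alpha^*\}$ over such representations; for $z\in M_n(V\otimes W)$, $\|z\|_\Delta=\inf\{\max\{|u|_\Delta,|u'|_\Delta\}:\begin{pmatrix} u & z \\ z^* & u' \end{pmatrix}\in M_{2n}(V\otimes_\Delta W)_+\}$. $M_n(V\otimes_\Delta W)^+$ is the $\|\cdot\|_\Delta$-closure of $M_n(V\otimes_\Delta W)_+$. $\delta$-structure: $M_n(V\otimes_\delta W)_+=\{z\in M_n(V\otimes W): (\varphi\otimes\psi)_n(z)\in M_{nkl}^+$ for all continuous c.p. maps $\varphi:V\to M_k$, $\psi:W\to M_l$, $k,l\in\mathbb N\}$; for $z$ in this set, $|z|_\delta=\sup\{\|(\varphi\otimes\psi)_n(z)\|: \varphi:V\to M_k,\ \psi:W\to M_l \text{ c.c.p.}, k,l\in\mathbb N\}$; for $z\in M_n(V\otimes W)$, $\|z\|_\delta=\inf\{\max\{|u|_\delta,|u'|_\delta\}:\begin{pmatrix} u & z \\ z^* & u' \end{pmatrix}\in M_{2n}(V\otimes_\delta W)_+\}$. $M_n(V\otimes_\delta W)^+$ is the $\|\cdot\|_\delta$-closure of $M_n(V\otimes_\delta W)_+$. *)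

(* Defs.v *)
From HB Require Import structures.
From mathcomp Require Import all_boot all_order all_algebra.
From mathcomp Require Import complex mxtens.
From mathcomp Require Import all_classical all_reals ereal.

Set Implicit Arguments.
Unset Strict Implicit.
Unset Printing Implicit Defensive.

Import Order.TTheory GRing.Theory Num.Theory.
Import ComplexField.Normc.
Local Open Scope ring_scope.
Local Open Scope classical_set_scope.
Local Open Scope quotient_scope.
Local Open Scope sesquilinear_scope.

(** Algebraic tensor product: formal sums [sum_i v_i (x) w_i], written as lists
    of pairs, modulo the congruence generated by the bilinearity relations.
    Scalars are absorbed in the first component. *)
Section Tensor.
Context {K : comNzRingType} (V W : lmodType K).

Inductive tens_eq : seq (V * W) -> seq (V * W) -> Prop :=
| tens_eq_refl s : tens_eq s s
| tens_eq_sym s t : tens_eq s t -> tens_eq t s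
| tens_eq_trans t s u : tens_eq s t -> tens_eq t u -> tens_eq s u
| tens_eq_cat s s' t t' :
    tens_eq s s' -> tens_eq t t' -> tens_eq (s ++ t) (s' ++ t')
| tens_eq_catC s t : tens_eq (s ++ t) (t ++ s)
| tens_eq_Dl v v' w : tens_eq [:: (v + v', w)] [:: (v, w); (v', w)]
| tens_eq_Dr v w w' : tens_eq [:: (v, w + w')] [:: (v, w); (v, w')]
| tens_eq_Z c v w : tens_eq [:: (c *: v, w)] [:: (v, c *: w)]
| tens_eq_0 w : tens_eq [:: (0, w)] [::].

Definition tens_rel : rel (seq (V * W)) := fun s t => `[< tens_eq s t >].

Lemma tens_rel_refl : reflexive tens_rel.
Proof. by move=> s; apply/asboolP; exact: tens_eq_refl. Qed.

Lemma tens_rel_sym : symmetric tens_rel.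
Proof. by move=> s t; apply/asboolP/asboolP; exact: tens_eq_sym. Qed.

Lemma tens_rel_trans : transitive tens_rel.
Proof.
move=> t s u /asboolP st /asboolP tu; apply/asboolP; exact: tens_eq_trans st tu.
Qed.

Canonical tens_equiv := EquivRel tens_rel tens_rel_refl tens_rel_sym tens_rel_trans.

Definition tensor := {eq_quot tens_rel}.
HB.instance Definition _ := Choice.on tensor.
HB.instance Definition _ := Quotient.on tensor.

Lemma tens_piP s t : reflect (tens_eq s t) (\pi_tensor s == \pi_tensor t).
Proof.
apply: (iffP eqP) => [/eqmodP /asboolP//|st].
by apply/eqmodP; apply/asboolP.
Qed.

Lemma tensW (P : tensor -> Prop) :
  (forall s, P (\pi_tensor s)) -> forall x, P x.
Proof. by move=> Ps x; rewrite -[x]reprK. Qed.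

Lemma tens_reprP s : tens_eq (repr (\pi_tensor s)) s.
Proof. by apply/tens_piP; rewrite reprK. Qed.

Definition fscale (c : K) (s : seq (V * W)) := [seq (c *: p.1, p.2) | p <- s].

Lemma fscale_eq c s t : tens_eq s t -> tens_eq (fscale c s) (fscale c t).
Proof.
elim=> {s t} [s|s t _|t s u _ + _|s s' t t' _ + _|s t|v v' w|v w w'|d v w|w].
- exact: tens_eq_refl.
- exact: tens_eq_sym.
- exact: tens_eq_trans.
- by rewrite /fscale !map_cat; exact: tens_eq_cat.
- by rewrite /fscale !map_cat; exact: tens_eq_catC.
- by rewrite /= scalerDr; exact: tens_eq_Dl.
- exact: tens_eq_Dr.
- by rewrite /= scalerA mulrC -scalerA; exact: tens_eq_Z.
- by rewrite /= scaler0; exact: tens_eq_0.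
Qed.

Definition tens_zero : tensor := \pi_tensor [::].
Definition tens_add (x y : tensor) : tensor := \pi_tensor (repr x ++ repr y).
Definition tens_scale (c : K) (x : tensor) : tensor := \pi_tensor (fscale c (repr x)).
Definition tens_opp (x : tensor) : tensor := tens_scale (-1) x.

Lemma tens_addE s t : tens_add (\pi_tensor s) (\pi_tensor t) = \pi_tensor (s ++ t).
Proof. by apply/eqP/tens_piP; apply: tens_eq_cat; exact: tens_reprP. Qed.

Lemma tens_scaleE c s : tens_scale c (\pi_tensor s) = \pi_tensor (fscale c s).
Proof. by apply/eqP/tens_piP; apply: fscale_eq; exact: tens_reprP. Qed.

Lemma tens_addA : associative tens_add.
Proof. by elim/tensW=> s; elim/tensW=> t; elim/tensW=> u; rewrite !tens_addE catA. Qed.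

Lemma tens_addC : commutative tens_add.
Proof.
elim/tensW=> s; elim/tensW=> t; rewrite !tens_addE.
by apply/eqP/tens_piP; exact: tens_eq_catC.
Qed.

Lemma tens_add0 : left_id tens_zero tens_add.
Proof. by elim/tensW=> s; rewrite !tens_addE. Qed.

Lemma tens_scaleDl_eq a b s : tens_eq (fscale (a + b) s) (fscale a s ++ fscale b s).
Proof.
elim: s => [|[v w] s ih] /=; first exact: tens_eq_refl.
rewrite -[_ :: fscale _ s]cat1s scalerDl.
apply: tens_eq_trans (tens_eq_cat (tens_eq_Dl _ _ _) ih) _ => /=.
rewrite -[in X in tens_eq X _]cat1s -[in X in tens_eq _ X]cat1s.
apply: tens_eq_cat; first exact: tens_eq_refl.
rewrite -cat1s -[_ :: fscale b s]cat1s !catA.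
by apply: tens_eq_cat; [exact: tens_eq_catC|exact: tens_eq_refl].
Qed.

Lemma tens_scaleDl x : {morph tens_scale^~ x : a b / a + b >-> tens_add a b}.
Proof.
move=> a b; elim/tensW: x => s; rewrite !tens_scaleE tens_addE.
by apply/eqP/tens_piP; exact: tens_scaleDl_eq.
Qed.

Lemma tens_scaleDr : right_distributive tens_scale tens_add.
Proof.
move=> c; elim/tensW=> s; elim/tensW=> t.
by rewrite !(tens_addE, tens_scaleE) /fscale map_cat.
Qed.

Lemma tens_scaleA a b x : tens_scale a (tens_scale b x) = tens_scale (a * b) x.
Proof.
elim/tensW: x => s; rewrite !tens_scaleE /fscale -map_comp.
by congr (\pi_tensor _); apply: eq_map => p /=; rewrite scalerA.
Qed.

Lemma tens_scale1 : left_id 1 tens_scale.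
Proof.
elim/tensW=> s; rewrite tens_scaleE /fscale (eq_map (g := id)) ?map_id //.
by case=> v w /=; rewrite scale1r.
Qed.

Lemma tens_scale0 x : tens_scale 0 x = tens_zero.
Proof.
elim/tensW: x => s; rewrite tens_scaleE; apply/eqP/tens_piP.
elim: s => [|[v w] s ih] /=; first exact: tens_eq_refl.
rewrite scale0r -cat1s -[X in tens_eq _ X]cats0.
by apply: tens_eq_cat => //; exact: tens_eq_0.
Qed.

Lemma tens_addN : left_inverse tens_zero tens_opp tens_add.
Proof.
move=> x; rewrite /tens_opp -{2}[x]tens_scale1 -tens_scaleDl addNr.
exact: tens_scale0.
Qed.

HB.instance Definition _ :=
  GRing.isZmodule.Build tensor tens_addA tens_addC tens_add0 tens_addN.
HB.instance Definition _ :=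
  GRing.Zmodule_isLmodule.Build K tensor
    tens_scaleA tens_scale1 tens_scaleDr tens_scaleDl.

Definition tens (v : V) (w : W) : tensor := \pi_tensor [:: (v, w)].

Lemma tensDl v v' w : tens (v + v') w = tens v w + tens v' w.
Proof.
by rewrite [RHS]tens_addE; apply/eqP/tens_piP; exact: tens_eq_Dl.
Qed.

Lemma tensDr v w w' : tens v (w + w') = tens v w + tens v w'.
Proof.
by rewrite [RHS]tens_addE; apply/eqP/tens_piP; exact: tens_eq_Dr.
Qed.

Lemma tensZl c v w : tens (c *: v) w = c *: tens v w.
Proof. by rewrite [RHS]tens_scaleE. Qed.

Lemma tensZr c v w : tens v (c *: w) = c *: tens v w.
Proof.
by rewrite -tensZl; apply/esym/eqP/tens_piP; exact: tens_eq_Z.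
Qed.

Lemma tens_piE s : \pi_tensor s = \sum_(p <- s) tens p.1 p.2.
Proof.
elim: s => [|[v w] s ih]; first by rewrite big_nil.
by rewrite big_cons -ih [RHS]tens_addE.
Qed.

Lemma tens_reprE (x : tensor) : x = \sum_(p <- repr x) tens p.1 p.2.
Proof. by rewrite -tens_piE reprK. Qed.

(* The additive map [v (x) w |-> f v w]; meaningful when [f] is balanced. *)
Definition tens_lift (U : zmodType) (f : V -> W -> U) (x : tensor) : U :=
  \sum_(p <- repr x) f p.1 p.2.

Definition balanced (U : zmodType) (f : V -> W -> U) :=
  [/\ forall v v' w, f (v + v') w = f v w + f v' w,
      forall v w w', f v (w + w') = f v w + f v w' &
      forall c v w, f (c *: v) w = f v (c *: w)].

Section Lift.
Context {U : zmodType} {f : V -> W -> U} (fP : balanced f).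

Lemma tens_lift_pi s : tens_lift f (\pi_tensor s) = \sum_(p <- s) f p.1 p.2.
Proof.
have [fDl fDr fZ] := fP; rewrite /tens_lift.
move: (tens_reprP s); move: (repr _) => t.
elim=> {s t} [s|s t _|t s u _ + _|s s' t t' _ + _|s t|v v' w|v w w'|d v w|w] //=.
- by move=> -> ->.
- by rewrite !big_cat /= => -> ->.
- by rewrite !big_cat /= addrC.
- by rewrite !big_cons !big_nil /= fDl !addr0.
- by rewrite !big_cons !big_nil /= fDr !addr0.
- by rewrite !big_cons !big_nil /= fZ.
- rewrite big_cons !big_nil addr0 /=; apply: (addrI (f 0 w)).
  by rewrite -fDl !addr0.
Qed.

Lemma tens_lift_tens v w : tens_lift f (tens v w) = f v w.
Proof. by rewrite tens_lift_pi big_seq1. Qed.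

Lemma tens_liftD x y : tens_lift f (x + y) = tens_lift f x + tens_lift f y.
Proof.
elim/tensW: x => s; elim/tensW: y => t.
by rewrite [\pi_tensor s + _]tens_addE !tens_lift_pi big_cat.
Qed.

End Lift.

Lemma tens_liftZ (U : lmodType K) (f : V -> W -> U) : balanced f ->
  (forall c v w, f (c *: v) w = c *: f v w) ->
  forall c x, tens_lift f (c *: x) = c *: tens_lift f x.
Proof.
move=> fP fZ c; elim/tensW=> s; rewrite [_ *: _]tens_scaleE.
rewrite !(tens_lift_pi fP) big_map scaler_sumr.
by apply: eq_bigr => p _; exact: fZ.
Qed.
End Tensor.

Arguments tens_lift {K V W U} f x.
Notation "V ⊗ W" := (tensor V W) (at level 40, left associativity) : type_scope.

Section TensorMap.
Context {K : comNzRingType} (V W : lmodType K) (k l : nat).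
Variables (phi : {linear V -> 'M[K]_k}) (psi : {linear W -> 'M[K]_l}).

Lemma tmap_balanced : balanced (fun v w => tensmx (phi v) (psi w)).
Proof.
split=> [v v' w|v w w'|c v w]; apply/matrixP=> i j; rewrite !mxE.
- by rewrite linearD mxE mulrDl.
- by rewrite linearD mxE mulrDr.
- by rewrite !linearZ !mxE mulrCA mulrA.
Qed.

(* [phi (x) psi], with values in [M_k (x) M_l = M_kl] (Kronecker product) *)
Definition tmap : V ⊗ W -> 'M[K]_(k * l) :=
  tens_lift (fun v w => tensmx (phi v) (psi w)).

Lemma tmap_tens v w : tmap (tens v w) = tensmx (phi v) (psi w).
Proof. exact: (tens_lift_tens tmap_balanced). Qed.

Lemma tmap_is_linear : linear tmap.
Proof.
move=> c x y; rewrite /tmap (tens_liftD tmap_balanced); congr (_ + _).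
apply: (tens_liftZ tmap_balanced) => a v w; apply/matrixP=> i j.
by rewrite !mxE linearZ !mxE mulrA.
Qed.

HB.instance Definition _ :=
  GRing.isLinear.Build K (V ⊗ W)%type 'M[K]_(k * l) *:%R tmap tmap_is_linear.

End TensorMap.

Section OperatorSpaces.
Context {R : realType}.
Local Notation C := R[i].

Definition l2norm n (x : 'cV[C]_n) : R := Num.sqrt (\sum_i normc (x i 0) ^+ 2).

Definition opnorm m n (A : 'M[C]_(m, n)) : R :=
  sup [set l2norm (A *m x) | x in [set x : 'cV[C]_n | l2norm x <= 1]].

(* [0 <= z] for [z : C] includes that [z] is real, so [A] is hermitian *)
Definition psdmx n (A : 'M[C]_n) : Prop :=
  forall x : 'cV[C]_n, 0 <= (x ^t* *m A *m x) 0 0.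

Section VMatrix.
Context {V : lmodType C}.

Definition vscale m n (c : C) (v : 'M[V]_(m, n)) : 'M[V]_(m, n) :=
  map_mx (fun x => c *: x) v.

(* [alpha v beta]; [mulmx] does not apply as [V] is not a ring *)
Definition vconj m p n q (alpha : 'M[C]_(n, m)) (v : 'M[V]_(m, p))
    (beta : 'M[C]_(p, q)) : 'M[V]_(n, q) :=
  \matrix_(i, j) \sum_r \sum_s (alpha i r * beta s j) *: v r s.

Definition star_mx m n (star : V -> V) (v : 'M[V]_(m, n)) : 'M[V]_(n, m) :=
  map_mx star v^T.

End VMatrix.

Definition matnorm (V : lmodType C) := forall n, 'M[V]_n -> R.
Definition matcone (V : lmodType C) := forall n, set 'M[V]_n.

Section Structures.
Context {V : lmodType C}.
Implicit Types (star : V -> V) (N : matnorm V) (P : matcone V).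

Record star_space star : Prop := {
  starD : forall x y, star (x + y) = star x + star y;
  starZ : forall c x, star (c *: x) = c^*%C *: star x;
  starK : forall x, star (star x) = x }.

Definition selfadj star n (v : 'M[V]_n) := star_mx star v = v.

(* Ruan's axioms *)
Record operator_space N : Prop := {
  os_eq0 : forall n (v : 'M[V]_n), N n v = 0 -> v = 0;
  os_scale : forall n c (v : 'M[V]_n), N n (vscale c v) = normc c * N n v;
  os_triangle : forall n (v w : 'M[V]_n), N n (v + w) <= N n v + N n w;
  os_dsum : forall m n (v : 'M[V]_m) (w : 'M[V]_n),
    N (m + n)%N (block_mx v 0 0 w) = Num.max (N m v) (N n w);
  os_conj : forall m n (alpha : 'M[C]_(n, m)) (v : 'M[V]_m) (beta : 'M[C]_(m, n)),
    N n (vconj alpha v beta) <= opnorm alpha * N m v * opnorm beta }.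

(* closure for an extended-real-valued matrix norm *)
Definition mclosure (N : forall n, 'M[V]_n -> \bar R) n (A : set 'M[V]_n)
    : set 'M[V]_n :=
  [set x | forall e : R, 0 < e -> exists2 y, A y & (N n (x - y)%R < e%:E)%E].

Record matrix_ordered star P : Prop := {
  mo_sa : forall n (v : 'M[V]_n), P n v -> selfadj star v;
  mo_0 : forall n, P n 0;
  mo_add : forall n (v w : 'M[V]_n), P n v -> P n w -> P n (v + w);
  mo_scale : forall n (t : R) (v : 'M[V]_n),
    0 <= t -> P n v -> P n (vscale (t%:C)%C v);
  mo_conj : forall m n (alpha : 'M[C]_(m, n)) (v : 'M[V]_m),
    P m v -> P n (vconj (alpha ^t*) v alpha) }.

Record matrix_ordered_operator_space star N P : Prop := {
  moos_star : star_space star;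
  moos_os : operator_space N;
  moos_mo : matrix_ordered star P;
  moos_isom : forall n (v : 'M[V]_n), N n (star_mx star v) = N n v;
  moos_closed : forall n (v : 'M[V]_n),
    mclosure (fun n x => (N n x)%:E) (P n) v -> P n v }.

Definition mle P n (v w : 'M[V]_n) := P n (w - v).

Record matrix_regular star N P : Prop := {
  mr_moos : matrix_ordered_operator_space star N P;
  mr_mono : forall n (u v : 'M[V]_n), selfadj star v -> P n u ->
    mle P (- u) v -> mle P v u -> N n v <= N n u;
  mr_dom : forall n (v : 'M[V]_n), selfadj star v -> N n v < 1 ->
    exists u, [/\ P n u, N n u < 1, mle P (- u) v & mle P v u] }.

End Structures.

(* the identification [M_n(M_k) = M_nk], outer index first *)

Definition mxflat k n (x : 'M['M[C]_k]_n) : 'M[C]_(n * k) :=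
  \matrix_(a, b) x (mxtens_unindex a).1 (mxtens_unindex b).1
                   (mxtens_unindex a).2 (mxtens_unindex b).2.

Definition Mnorm k : matnorm 'M[C]_k := fun n x => opnorm (mxflat x).
Definition Mcone k : matcone 'M[C]_k := fun n => [set x | psdmx (mxflat x)].

Section Maps.
Context {V W : lmodType C}.
Implicit Types (f : {linear V -> W}).

Definition cp (PV : matcone V) (PW : matcone W) f :=
  forall n (v : 'M[V]_n), PV n v -> PW n (map_mx f v).

Definition ccontractive (NV : matnorm V) (NW : matnorm W) f :=
  forall n (v : 'M[V]_n), NW n (map_mx f v) <= NV n v.

Definition ccp NV PV NW PW f := cp PV PW f /\ ccontractive NV NW f.

(* continuity for the norms of [V = M_1(V)] and [W = M_1(W)] *)
Definition mcontinuous (NV : matnorm V) (NW : matnorm W) f :=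
  forall (x : V) (e : R), 0 < e -> exists2 d : R, 0 < d &
    forall y, NV 1%N (const_mx (y - x)) < d -> NW 1%N (const_mx (f y - f x)) < e.

End Maps.

Section TensorStructures.
Context {V W : lmodType C}.

Definition tens_star (sV : V -> V) (sW : W -> W) : V ⊗ W -> V ⊗ W :=
  tens_lift (fun v w => tens (sV v) (sW w)).

Lemma tens_star_tens sV sW : star_space sV -> star_space sW ->
  forall v w, tens_star sV sW (tens v w) = tens (sV v) (sW w).
Proof.
move=> [VD VZ _] [WD WZ _] v w; apply: tens_lift_tens; split=> [a b c|a b c|c a b].
- by rewrite VD tensDl.
- by rewrite WD tensDr.
- by rewrite VZ WZ tensZl tensZr.
Qed.

Definition vtens k l (v : 'M[V]_k) (w : 'M[W]_l) : 'M[V ⊗ W]_(k * l) :=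
  \matrix_(a, b) tens (v (mxtens_unindex a).1 (mxtens_unindex b).1)
                      (w (mxtens_unindex a).2 (mxtens_unindex b).2).

Variables (sV : V -> V) (NV : matnorm V) (PV : matcone V).
Variables (sW : W -> W) (NW : matnorm W) (PW : matcone W).

(* Infima and suprema are taken in the extended reals. [pos] is the
   family [M_n(-)_+] and [nu] the functional [|.|], for Delta or delta. *)
Definition block_norm (pos : matcone (V ⊗ W))
    (nu : forall n, 'M[V ⊗ W]_n -> \bar R) n (z : 'M[V ⊗ W]_n) : \bar R :=
  ereal_inf [set e | exists u u',
    pos (n + n)%N (block_mx u z (star_mx (tens_star sV sW) z) u') /\
    e = maxe (nu n u) (nu n u')].

Definition Delta_rep n (z : 'M[V ⊗ W]_n) k l (alpha : 'M[C]_(n, k * l))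
    (v : 'M[V]_k) (w : 'M[W]_l) :=
  [/\ PV v, PW w & z = vconj alpha (vtens v w) (alpha ^t*)].

Definition Delta_pos : matcone (V ⊗ W) := fun n =>
  [set z | exists k l (alpha : 'M[C]_(n, k * l)) v w, Delta_rep z alpha v w].

Definition Delta_nu n (z : 'M[V ⊗ W]_n) : \bar R :=
  ereal_inf [set e | exists k l (alpha : 'M[C]_(n, k * l)) v w,
    Delta_rep z alpha v w /\ e = (opnorm alpha ^+ 2 * NV v * NW w)%:E].

Definition Delta_norm := block_norm Delta_pos Delta_nu.
Definition Delta_cone : matcone (V ⊗ W) := fun n => mclosure Delta_norm (@Delta_pos n).

Definition delta_pos : matcone (V ⊗ W) := fun n =>
  [set z | forall k l (phi : {linear V -> 'M[C]_k}) (psi : {linear W -> 'M[C]_l}),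
    mcontinuous NV (@Mnorm k) phi -> cp PV (@Mcone k) phi ->
    mcontinuous NW (@Mnorm l) psi -> cp PW (@Mcone l) psi ->
    Mcone (map_mx (tmap phi psi) z)].

Definition delta_nu n (z : 'M[V ⊗ W]_n) : \bar R :=
  ereal_sup [set e | exists k l (phi : {linear V -> 'M[C]_k})
      (psi : {linear W -> 'M[C]_l}),
    [/\ ccp NV PV (@Mnorm k) (@Mcone k) phi,
        ccp NW PW (@Mnorm l) (@Mcone l) psi &
        e = (Mnorm (map_mx (tmap phi psi) z))%:E]].

Definition delta_norm := block_norm delta_pos delta_nu.
Definition delta_cone : matcone (V ⊗ W) := fun n => mclosure delta_norm (@delta_pos n).

End TensorStructures.
End OperatorSpaces.

(* Main.v *)
Require Import Defs.
From HB Require Import structures.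
From mathcomp Require Import all_boot all_order all_algebra.
From mathcomp Require Import complex mxtens.
From mathcomp Require Import all_classical all_reals ereal.
From mathcomp Require Import lra.

Set Implicit Arguments.
Unset Strict Implicit.
Unset Printing Implicit Defensive.

Import Order.TTheory GRing.Theory Num.Theory.
Import ComplexField.Normc.
Local Open Scope ring_scope.
Local Open Scope classical_set_scope.
Local Open Scope sesquilinear_scope.

(** A matrix regular norm is recovered from the cones: conjugating by
    [diag(1, -1)] turns positivity of [[u, z], [z*, u']] into the order bounds
    [-diag(u, u') <= [[0, z], [z*, 0]] <= diag(u, u')], so that [|z| < t] iff
    such a positive block exists with [|u|, |u'| < t].

    For Delta, every [alpha (v (x) w) alpha*] is positive in [V (x)_alpha W]
    with norm at most [|alpha|^2 |v| |w|], and the block description bounds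
    [|z|]. For delta, a continuous map into [M_k] is completely bounded, as
    each of its entries is a bounded functional; a continuous c.p. map is thus
    a positive multiple of a c.c.p. one, and positivity in [V (x)_alpha W]
    passes to the cone defining delta. *)

(** * Euclidean and operator norms of complex matrices *)

Section ScalarMatrices.
Context {R : realType}.
Local Notation C := R[i].

(** Summing [(B a_i - A b_i)^2 >= 0] gives the bound multiplied by [2 A B]; when [A] or [B]
    vanishes, so does every entry of the corresponding family. *)
Lemma cauchy_schwarz (I : finType) (a b : I -> R) :
  \sum_i a i * b i <= Num.sqrt (\sum_i a i ^+ 2) * Num.sqrt (\sum_i b i ^+ 2).
Proof.
set A := Num.sqrt _; set B := Num.sqrt _.
have sq_ge0 (f : I -> R) : 0 <= \sum_i f i ^+ 2.
  by apply: sumr_ge0 => i _; exact: sqr_ge0.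
have sq_eq0 (f : I -> R) : Num.sqrt (\sum_i f i ^+ 2) = 0 -> forall i, f i = 0.
  move/eqP; rewrite sqrtr_eq0 => f0 i.
  have /eqP : \sum_i f i ^+ 2 = 0 by apply/eqP; rewrite eq_le f0 sq_ge0.
  rewrite psumr_eq0 => [/allP/(_ i)|? _]; last exact: sqr_ge0.
  by rewrite mem_index_enum sqrf_eq0 => /(_ isT)/eqP.
have [A0|A0] := eqVneq A 0.
  by rewrite A0 mul0r big1 // => i _; rewrite (sq_eq0 _ A0) mul0r.
have [B0|B0] := eqVneq B 0.
  by rewrite B0 mulr0 big1 // => i _; rewrite (sq_eq0 _ B0) mulr0.
have Agt0 : 0 < A by rewrite lt_def A0 sqrtr_ge0.
have Bgt0 : 0 < B by rewrite lt_def B0 sqrtr_ge0.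
have ABgt0 : 0 < 2 * (A * B) by rewrite !mulr_gt0.
rewrite -(ler_pM2l ABgt0) mulr_sumr.
apply: (@le_trans _ _ (\sum_i (B ^+ 2 * a i ^+ 2 + A ^+ 2 * b i ^+ 2))).
  apply: ler_sum => i _; have := sqr_ge0 (B * a i - A * b i); lra.
rewrite big_split /= -!mulr_sumr.
have := sqr_sqrtr (sq_ge0 a); have := sqr_sqrtr (sq_ge0 b).
by rewrite -/A -/B => <- <-; lra.
Qed.

Lemma normc_ge0 (x : C) : 0 <= normc x.
Proof. by case: x => a b; exact: sqrtr_ge0. Qed.

Lemma normc_conj (x : C) : normc (Num.conj x) = normc x.
Proof. by case: x => a b /=; rewrite sqrrN. Qed.

Lemma normc_sum (I : Type) (r : seq I) (P : pred I) (F : I -> C) :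
  normc (\sum_(i <- r | P i) F i) <= \sum_(i <- r | P i) normc (F i).
Proof.
elim/big_rec2: _ => [|i y x _ h]; first by rewrite normc0.
by apply: le_trans (le_normcD _ _) _; rewrite lerD2l.
Qed.

Lemma sum_normc2_ge0 (I : finType) (f : I -> C) : 0 <= \sum_i normc (f i) ^+ 2.
Proof. by apply: sumr_ge0 => i _; exact: sqr_ge0. Qed.

Lemma l2norm_ge0 n (x : 'cV[C]_n) : 0 <= l2norm x.
Proof. exact: sqrtr_ge0. Qed.

Lemma l2norm_sqr n (x : 'cV[C]_n) : l2norm x ^+ 2 = \sum_i normc (x i 0) ^+ 2.
Proof. by rewrite sqr_sqrtr // sum_normc2_ge0. Qed.

Lemma l2norm_entry n (x : 'cV[C]_n) i : normc (x i 0) <= l2norm x.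
Proof.
rewrite -(ler_pXn2r (n := 2)) ?nnegrE ?normc_ge0 ?l2norm_ge0 // l2norm_sqr.
by rewrite (bigD1 i) //= lerDl sumr_ge0 // => j _; exact: sqr_ge0.
Qed.

Lemma l2norm0 n : l2norm (0 : 'cV[C]_n) = 0.
Proof. by rewrite /l2norm big1 ?sqrtr0 // => i _; rewrite mxE normc0 expr0n. Qed.

Lemma l2norm_eq0 n (x : 'cV[C]_n) : l2norm x = 0 -> x = 0.
Proof.
move=> x0; apply/matrixP => i j; rewrite ord1 mxE; apply: eq0_normc.
by apply: le_anti; rewrite normc_ge0 -x0 l2norm_entry.
Qed.

Lemma l2normZ n c (x : 'cV[C]_n) : l2norm (c *: x) = normc c * l2norm x.
Proof.
rewrite /l2norm -[normc c](ger0_norm (normc_ge0 c)) -sqrtr_sqr -sqrtrM ?sqr_ge0 //.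
by rewrite mulr_sumr; congr Num.sqrt; apply: eq_bigr => i _; rewrite mxE normcM exprMn.
Qed.

Lemma normc_real (r : R) : 0 <= r -> normc (r%:C)%C = r.
Proof. by move=> r0; rewrite /normc /= expr0n addr0 sqrtr_sqr ger0_norm. Qed.

Lemma dot_le n (x y : 'cV[C]_n) : normc ((y^T *m x) 0 0) <= l2norm y * l2norm x.
Proof.
rewrite mxE; apply: le_trans (normc_sum _ _ _) _.
under eq_bigr do rewrite normcM mxE.
exact: cauchy_schwarz.
Qed.

Lemma dot_conj n (x : 'cV[C]_n) : ((x ^t*) *m x) 0 0 = ((l2norm x ^+ 2)%:C)%C.
Proof.
rewrite mxE l2norm_sqr raddf_sum; apply: eq_bigr => i _ /=.
rewrite !mxE; case: (x i 0) => a b; apply/eqP; rewrite eq_complex /=.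
by rewrite sqr_sqrtr ?addr_ge0 ?sqr_ge0 //; apply/andP; split; apply/eqP; lra.
Qed.

(** The Frobenius norm: an explicit bound showing that the supremum in [opnorm] is taken over a
    bounded set. *)
Definition frob m n (A : 'M[C]_(m, n)) : R :=
  Num.sqrt (\sum_i \sum_j normc (A i j) ^+ 2).

Lemma frob_ge0 m n (A : 'M[C]_(m, n)) : 0 <= frob A.
Proof. exact: sqrtr_ge0. Qed.

Lemma l2norm_mul_frob m n (A : 'M[C]_(m, n)) x : l2norm (A *m x) <= frob A * l2norm x.
Proof.
rewrite -(ler_pXn2r (n := 2)) ?nnegrE ?mulr_ge0 ?l2norm_ge0 ?frob_ge0 //.
rewrite exprMn l2norm_sqr [frob A ^+ 2]sqr_sqrtr; last first.
  by do 2![apply: sumr_ge0 => ? _]; exact: sqr_ge0.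
rewrite mulr_suml; apply: ler_sum => i _.
have -> : (A *m x) i 0 = (((row i A)^T)^T *m x) 0 0.
  by rewrite trmxK !mxE; apply: eq_bigr => j _; rewrite !mxE.
have -> : \sum_j normc (A i j) ^+ 2 = l2norm ((row i A)^T) ^+ 2.
  by rewrite l2norm_sqr; apply: eq_bigr => j _; rewrite !mxE.
rewrite -exprMn ler_pXn2r ?nnegrE ?normc_ge0 ?mulr_ge0 ?l2norm_ge0 //.
exact: dot_le.
Qed.

Lemma opnorm_le m n (A : 'M[C]_(m, n)) M : 0 <= M ->
  (forall x, l2norm (A *m x) <= M * l2norm x) -> opnorm A <= M.
Proof.
move=> M0 AM; apply: ge_sup.
  by exists (l2norm (A *m 0)); exists 0 => //=; rewrite l2norm0.
move=> _ [x /= x1 <-]; apply: le_trans (AM x) _.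
by rewrite -[leRHS]mulr1 ler_wpM2l.
Qed.

Lemma opnorm_le_frob m n (A : 'M[C]_(m, n)) : opnorm A <= frob A.
Proof. by apply: opnorm_le (frob_ge0 _) _ => x; exact: l2norm_mul_frob. Qed.

Lemma l2norm_mul_le1 m n (A : 'M[C]_(m, n)) x :
  l2norm x <= 1 -> l2norm (A *m x) <= opnorm A.
Proof.
move=> x1; apply: ub_le_sup; last by exists x.
exists (frob A) => _ [y /= y1 <-]; apply: le_trans (l2norm_mul_frob _ _) _.
by rewrite -[leRHS]mulr1 ler_wpM2l ?frob_ge0.
Qed.

Lemma opnorm_ge0 m n (A : 'M[C]_(m, n)) : 0 <= opnorm A.
Proof.
by apply: le_trans (l2norm_ge0 (A *m 0)) (l2norm_mul_le1 _ _); rewrite l2norm0.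
Qed.

Lemma l2norm_mul m n (A : 'M[C]_(m, n)) x : l2norm (A *m x) <= opnorm A * l2norm x.
Proof.
have [/l2norm_eq0 ->|x0] := eqVneq (l2norm x) 0; first by rewrite mulmx0 !l2norm0 mulr0.
have xgt0 : 0 < l2norm x by rewrite lt_def x0 l2norm_ge0.
have n1 : normc ((l2norm x)^-1%:C)%C = (l2norm x)^-1.
  by rewrite normc_real ?invr_ge0 ?l2norm_ge0.
have := @l2norm_mul_le1 _ _ A (((l2norm x)^-1%:C)%C *: x).
by rewrite -scalemxAr !l2normZ n1 mulVf // => /(_ (lexx _)); rewrite mulrC ler_pdivrMr.
Qed.

Lemma l2norm_conj n (x : 'cV[C]_n) : l2norm (map_mx Num.conj x) = l2norm x.
Proof. by congr Num.sqrt; apply: eq_bigr => i _; rewrite mxE normc_conj. Qed.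

(** Taking for [y] the entrywise conjugate of [A x] turns the form into [|A x|^2], and one factor
    [|A x|] cancels. *)
Lemma opnorm_le_dot m n (A : 'M[C]_(m, n)) M : 0 <= M ->
  (forall x y, normc ((y^T *m A *m x) 0 0) <= M * l2norm y * l2norm x) -> opnorm A <= M.
Proof.
move=> M0 AM; apply: opnorm_le => // x.
have := AM x (map_mx Num.conj (A *m x)).
rewrite l2norm_conj -mulmxA map_trmx dot_conj normc_real ?sqr_ge0 // expr2.
have [->|Ax0] := eqVneq (l2norm (A *m x)) 0; first by rewrite mulr_ge0 ?l2norm_ge0.
by rewrite mulrAC ler_pM2r // lt_def Ax0 l2norm_ge0.
Qed.

(** In the bilinear form the adjoint moves to [y] as the entrywise conjugate of [A], and entrywise
    conjugation preserves [l2norm]. *)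
Lemma opnorm_adj_le m n (A : 'M[C]_(m, n)) : opnorm (A ^t*) <= opnorm A.
Proof.
apply: opnorm_le_dot => [|x y]; first exact: opnorm_ge0.
have -> : (y^T *m A ^t* *m x) 0 0 = ((map_mx Num.conj A *m y)^T *m x) 0 0.
  by rewrite trmx_mul map_trmx.
apply: le_trans (dot_le _ _) _; apply: ler_wpM2r; first exact: l2norm_ge0.
have -> : map_mx Num.conj A *m y = map_mx Num.conj (A *m map_mx Num.conj y).
  rewrite map_mxM /=; congr (_ *m _); apply/matrixP => i j; rewrite !mxE.
  by rewrite conjCK.
by rewrite l2norm_conj -[l2norm y]l2norm_conj l2norm_mul.
Qed.

Lemma opnorm_adj m n (A : 'M[C]_(m, n)) : opnorm (A ^t*) = opnorm A.
Proof. by apply: le_anti; rewrite opnorm_adj_le -{1}[A]trmxCK opnorm_adj_le. Qed.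

Lemma opnorm_entry m n (A : 'M[C]_(m, n)) i j : normc (A i j) <= opnorm A.
Proof.
have -> : A i j = (A *m (delta_mx j 0 : 'cV[C]_n)) i 0 by rewrite -colE mxE.
apply: le_trans (l2norm_entry _ _) (l2norm_mul_le1 _ _).
rewrite /l2norm (bigD1 j) //= !mxE !eqxx big1 => [|k /negPf kj].
  by rewrite normc1 expr1n addr0 sqrtr1.
by rewrite mxE kj normc0 expr0n.
Qed.

Lemma psdmxZ n (t : R) (A : 'M[C]_n) : 0 <= t -> psdmx A -> psdmx ((t%:C)%C *: A).
Proof.
move=> t0 A0 x; rewrite -scalemxAr -scalemxAl mxE mulr_ge0 //.
by rewrite lecE /= eqxx.
Qed.

(* The matrix whose [i]-th row is [e i] times the [f i]-th basis vector:
   coordinate embeddings, swaps and sign changes all have this shape. *)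
Definition monomial_mx m n (f : 'I_m -> 'I_n) (e : 'I_m -> C) : 'M[C]_(m, n) :=
  \matrix_(i, r) (e i *+ (r == f i)).

Lemma opnorm_monomial m n (f : 'I_m -> 'I_n) (e : 'I_m -> C) :
  injective f -> (forall i, normc (e i) <= 1) -> opnorm (monomial_mx f e) <= 1.
Proof.
move=> finj e1; apply: opnorm_le => // x; rewrite mul1r.
rewrite -(ler_pXn2r (n := 2)) ?nnegrE ?l2norm_ge0 // !l2norm_sqr.
(* Coordinates outside the image of [f] only enlarge the right side; injectivity lets the others be
   reindexed by ['I_m]. *)
rewrite (bigID (fun r => r \in codom f)) /=.
apply: ler_wpDr; first by apply: sumr_ge0 => i _; exact: sqr_ge0.
rewrite [leRHS](eq_bigl (fun r => r \in finset.imset f (mem 'I_m))); last first.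
  move=> r; apply/codomP/imsetP => -[j].
    by move=> ->; exists j; rewrite ?inE.
  by move=> _ ->; exists j.
rewrite big_imset /=; last by move=> i j _ _; exact: finj.
rewrite [leRHS](eq_bigl xpredT) => [|i]; last by rewrite inE.
apply: ler_sum => i _; rewrite mxE (bigD1 (f i)) //= mxE eqxx mulr1n big1 ?addr0.
  by rewrite normcM ler_pXn2r ?nnegrE ?mulr_ge0 ?normc_ge0 // ler_piMl ?normc_ge0.
by move=> r /negPf rf; rewrite mxE rf mulr0n mul0r.
Qed.

End ScalarMatrices.

(** * Conjugation of matrices over [V] by monomial scalar matrices *)

Section VectorMatrices.
Context {R : realType} {V : lmodType R[i]}.
Local Notation C := R[i].

Lemma vscaleD m n c (v w : 'M[V]_(m, n)) : vscale c (v + w) = vscale c v + vscale c w.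
Proof. by apply/matrixP => i j; rewrite !mxE scalerDr. Qed.

Lemma vscaleN m n c (v : 'M[V]_(m, n)) : vscale c (- v) = - vscale c v.
Proof. by apply/matrixP => i j; rewrite !mxE scalerN. Qed.

Lemma vscaleA m n a b (v : 'M[V]_(m, n)) : vscale a (vscale b v) = vscale (a * b) v.
Proof. by apply/matrixP => i j; rewrite !mxE scalerA. Qed.

Lemma vscale1 m n (v : 'M[V]_(m, n)) : vscale 1 v = v.
Proof. by apply/matrixP => i j; rewrite !mxE scale1r. Qed.

Lemma vscale0 m n (v : 'M[V]_(m, n)) : vscale 0 v = 0.
Proof. by apply/matrixP => i j; rewrite !mxE scale0r. Qed.

Lemma vscaleKr m n (t : R) (v : 'M[V]_(m, n)) : t != 0 ->
  vscale (t%:C)%C (vscale (t^-1%:C)%C v) = v.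
Proof. by move=> t0; rewrite vscaleA -rmorphM /= mulfV // vscale1. Qed.

Lemma vscale_half m n (v : 'M[V]_(m, n)) : vscale (2^-1%:C)%C (v + v) = v.
Proof.
by rewrite vscaleD; apply/matrixP => i j; rewrite !mxE -scalerDl -rmorphD /=
  -mulr2n -(mulr_natr (2^-1)) mulVf ?scale1r.
Qed.

Lemma vconj_monomial m n p q (f : 'I_m -> 'I_n) e (v : 'M[V]_(n, q))
    (g : 'I_p -> 'I_q) d :
  vconj (monomial_mx f e) v ((monomial_mx g d) ^t*) =
  \matrix_(i, j) ((e i * Num.conj (d j)) *: v (f i) (g j)).
Proof.
apply/matrixP => i j; rewrite !mxE (bigD1 (f i)) //= (bigD1 (g j)) //=.
rewrite !mxE !eqxx !mulr1n [X in _ + X + _]big1 => [|s /negPf sg]; last first.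
  by rewrite !mxE sg mulr0n conjC0 mulr0 scale0r.
rewrite addr0 big1 ?addr0 // => r /negPf rf; rewrite big1 // => s _.
by rewrite mxE rf mulr0n mul0r scale0r.
Qed.

(** Selecting rows and columns is a two-sided scalar multiplication, which brings it within reach of
    Ruan's axiom [os_conj]. *)
Lemma vconj_mxsub m n p q (f : 'I_m -> 'I_n) (v : 'M[V]_(n, q)) (g : 'I_p -> 'I_q) :
  vconj (monomial_mx f (fun=> 1)) v ((monomial_mx g (fun=> 1)) ^t*) = mxsub f g v.
Proof.
by rewrite vconj_monomial; apply/matrixP => i j; rewrite !mxE conjC1 mulr1 scale1r.
Qed.

(** The diagonal of [diag(1, -1)] with blocks of size [n], used as weights of a monomial matrix. *)
Definition half_sign n (i : 'I_(n + n)) : C :=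
  if fintype.split i is inl _ then 1 else -1.

Lemma half_sign_lshift n (i : 'I_n) : half_sign (lshift n i) = 1.
Proof. by rewrite /half_sign (unsplitK (inl i)). Qed.

Lemma half_sign_rshift n (i : 'I_n) : half_sign (rshift n i) = -1.
Proof. by rewrite /half_sign (unsplitK (inr i)). Qed.

Lemma vconj_half_sign n (a b c d : 'M[V]_n) :
  vconj (monomial_mx id (@half_sign n)) (block_mx a b c d)
    ((monomial_mx id (@half_sign n)) ^t*) = block_mx a (- b) (- c) d.
Proof.
rewrite vconj_monomial; apply/matrixP => i j; rewrite [LHS]mxE.
by case: (split_ordP i) => i' ->; case: (split_ordP j) => j' ->;
  rewrite ?half_sign_lshift ?half_sign_rshift ?rmorphN1 ?conjC1 ?mulr1 ?mulrN1 ?opprK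
    ?block_mxEul ?block_mxEur ?block_mxEdl ?block_mxEdr ?mxE ?scaleN1r ?scale1r.
Qed.

(** Applied to columns, this permutation carries block-diagonal matrices to block-off-diagonal
    ones. *)
Definition swap_half n (i : 'I_(n + n)) : 'I_(n + n) :=
  match fintype.split i with inl j => rshift n j | inr j => lshift n j end.

Lemma swap_half_lshift n (i : 'I_n) : swap_half (lshift n i) = rshift n i.
Proof. by rewrite /swap_half (unsplitK (inl i)). Qed.

Lemma swap_half_rshift n (i : 'I_n) : swap_half (rshift n i) = lshift n i.
Proof. by rewrite /swap_half (unsplitK (inr i)). Qed.

Lemma swap_halfK n : involutive (@swap_half n).
Proof.
by move=> i; case: (split_ordP i) => j ->;
  rewrite ?(swap_half_lshift, swap_half_rshift).
Qed.

End VectorMatrices.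

(** * Consequences of Ruan's axioms and of the matrix order *)

Section MatrixRegular.
Context {R : realType} {V : lmodType R[i]}.
Local Notation C := R[i].
Context {star : V -> V} {N : matnorm V} {P : matcone V}.
Hypothesis hN : operator_space N.

Lemma os_norm0 n : N (0 : 'M[V]_n) = 0.
Proof. by rewrite -(vscale0 0) (os_scale hN) normc0 mul0r. Qed.

Lemma os_normN n (v : 'M[V]_n) : N (- v) = N v.
Proof.
have -> : - v = vscale (-1) v by apply/matrixP => i j; rewrite !mxE scaleN1r.
by rewrite (os_scale hN) normcN normc1 mul1r.
Qed.

(** Nonnegativity follows from the triangle inequality: [0 = N (v - v) <= 2 N v]. *)
Lemma os_norm_ge0 n (v : 'M[V]_n) : 0 <= N v.
Proof. by have := os_triangle hN v (- v); rewrite subrr os_norm0 os_normN; lra. Qed.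

(** By injectivity both selecting matrices are contractions. Independent [f] and [g] cover
    off-diagonal blocks and column swaps. *)
Lemma os_norm_mxsub m n (f g : 'I_m -> 'I_n) (v : 'M[V]_n) :
  injective f -> injective g -> N (mxsub f g v) <= N v.
Proof.
move=> finj ginj; rewrite -vconj_mxsub; apply: le_trans (os_conj hN _ _ _) _.
have e1 (i : 'I_m) : normc (1 : C) <= 1 by rewrite normc1.
rewrite opnorm_adj -[leRHS]mulr1.
rewrite ler_pM ?mulr_ge0 ?opnorm_ge0 ?os_norm_ge0 ?opnorm_monomial //.
by rewrite ler_piMl ?os_norm_ge0 ?opnorm_monomial.
Qed.

Lemma os_norm_offdiag n (x y : 'M[V]_n) :
  N (block_mx 0 x y 0) <= Num.max (N x) (N y).
Proof.
have -> : block_mx 0 x y 0 = mxsub id (@swap_half n) (block_mx x 0 0 y).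
  apply/matrixP => i j; rewrite [RHS]mxE.
  by case: (split_ordP i) => i' ->; case: (split_ordP j) => j' ->;
    rewrite ?swap_half_lshift ?swap_half_rshift
      ?block_mxEul ?block_mxEur ?block_mxEdl ?block_mxEdr.
rewrite -(os_dsum hN); apply: os_norm_mxsub => //.
exact: inv_inj (@swap_halfK n).
Qed.

Hypothesis hP : matrix_ordered star P.

Lemma mo_congr m n (a : 'M[C]_(n, m)) (v : 'M[V]_m) :
  P v -> P (vconj a v (a ^t*)).
Proof. by move=> Pv; have := mo_conj hP (a ^t*) Pv; rewrite trmxCK. Qed.

Lemma mo_block_neg n (a b c d : 'M[V]_n) :
  P (block_mx a b c d) -> P (block_mx a (- b) (- c) d).
Proof. by move=> Pv; rewrite -vconj_half_sign; exact: mo_congr. Qed.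

Lemma mo_half n (v : 'M[V]_n) : P (v + v) -> P v.
Proof. by rewrite -{3}[v]vscale_half; apply: (mo_scale hP); rewrite invr_ge0. Qed.

End MatrixRegular.

(** * Recovering the norm from positive two-by-two blocks *)

Section BlockCharacterization.
Context {R : realType} {V : lmodType R[i]}.
Local Notation C := R[i].
Context {star : V -> V} {N : matnorm V} {P : matcone V}.
Hypothesis hV : matrix_regular star N P.
Let hmoos := mr_moos hV.
Let hS := moos_star hmoos.
Let hN := moos_os hmoos.
Let hP := moos_mo hmoos.

Lemma star0 : star 0 = 0.
Proof. by have := starZ hS 0 0; rewrite scale0r conjc0 scale0r. Qed.

Lemma star_mxK m n (v : 'M[V]_(m, n)) : star_mx star (star_mx star v) = v.
Proof. by apply/matrixP => i j; rewrite !mxE (starK hS). Qed.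

Lemma star_mx0 m n : star_mx star (0 : 'M[V]_(m, n)) = 0.
Proof. by apply/matrixP => i j; rewrite !mxE star0. Qed.

Lemma star_mx_scale n (t : R) (v : 'M[V]_n) :
  star_mx star (vscale (t%:C)%C v) = vscale (t%:C)%C (star_mx star v).
Proof. by apply/matrixP => i j; rewrite !mxE (starZ hS) conjc_real. Qed.

Lemma selfadj_offdiag n (x : 'M[V]_n) :
  selfadj star (block_mx 0 x (star_mx star x) 0).
Proof.
by rewrite /selfadj [LHS]/star_mx tr_block_mx map_block_mx
  -![map_mx star _^T]/(star_mx star _) star_mxK !star_mx0.
Qed.

(** This is [mr_dom] at radius [t] instead of 1, by rescaling; [t] is positive because norms are
    nonnegative. *)
Lemma mr_dom_lt n (v : 'M[V]_n) t : selfadj star v -> N v < t ->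
  exists u, [/\ P u, N u < t, P (v + u) & P (u - v)].
Proof.
move=> sv vt; have t0 : 0 < t := le_lt_trans (os_norm_ge0 hN v) vt.
have tn0 : t != 0 by rewrite gt_eqF.
have ti0 : 0 <= t^-1 by rewrite invr_ge0 ltW.
have [||u [Pu u1]] := mr_dom hV (v := vscale (t^-1%:C)%C v).
- by rewrite /selfadj star_mx_scale sv.
- by rewrite (os_scale hN) normc_real // mulrC ltr_pdivrMr // mul1r.
rewrite /mle opprK => /(mo_scale hP (ltW t0)) vu /(mo_scale hP (ltW t0)) uv.
exists (vscale (t%:C)%C u); split.
- exact: (mo_scale hP (ltW t0) Pu).
- by rewrite (os_scale hN) normc_real ?ltW // -[ltRHS]mulr1 ltr_pM2l.
- by rewrite vscaleD vscaleKr in vu.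
- by rewrite vscaleD vscaleN vscaleKr in uv.
Qed.

(** The block and its sign-flipped copy are [diag(u, u')] plus and minus the off-diagonal matrix
    [v], and their sum is [2 diag(u, u')]. So [mr_mono] bounds [v], and [z] is a corner of [v]. *)
Lemma norm_le_block n (z u u' : 'M[V]_n) :
  P (block_mx u z (star_mx star z) u') -> N z <= Num.max (N u) (N u').
Proof.
move=> PT; have PT' := mo_block_neg hP PT.
pose v := block_mx 0 z (star_mx star z) 0.
have zE : z = mxsub (@lshift n n) (@rshift n n) v.
  by apply/matrixP => i j; rewrite mxE block_mxEur.
rewrite -(os_dsum hN) zE.
apply: le_trans (os_norm_mxsub hN v (@lshift_inj _ _) (@rshift_inj _ _)) _.
apply: (mr_mono hV (selfadj_offdiag z)).
- apply: (mo_half hP); have := mo_add hP PT PT'.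
  by rewrite !add_block_mx !subrr !addr0.
- by rewrite /mle opprK add_block_mx !(add0r, addr0).
- by rewrite /mle opp_block_mx add_block_mx !(add0r, subr0, oppr0, addr0).
Qed.

(** Let [U] dominate plus and minus the off-diagonal matrix of [z]. Adding the sign-flipped [U - v]
    to [v + U] cancels the off-diagonal corners of [U] and leaves twice the wanted block, with the
    diagonal corners of [U] as [u] and [u']. *)
Lemma block_of_norm_lt n (z : 'M[V]_n) t : N z < t ->
  exists u u', [/\ P (block_mx u z (star_mx star z) u'), N u < t & N u' < t].
Proof.
move=> zt; have := mr_dom_lt (t := t) (selfadj_offdiag z).
case=> [|U [_ Ut]].
  apply: le_lt_trans (os_norm_offdiag hN _ _) _.
  by rewrite (moos_isom hmoos) maxxx.
rewrite -[U]submxK; set a := ulsubmx U; set d := drsubmx U.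
rewrite opp_block_mx !add_block_mx !(add0r, subr0, oppr0, addr0) => PT.
move/(mo_block_neg hP)/(mo_add hP PT) => PS.
exists a, d; split.
- apply: (mo_half hP); move: PS.
  have addBl (x y : 'M[V]_n) : x + y + (x - y) = x + x by rewrite addrACA subrr addr0.
  by rewrite !add_block_mx !opprB !addBl.
- apply: le_lt_trans Ut; have -> : a = mxsub (@lshift n n) (@lshift n n) U.
    by apply/matrixP => i j; rewrite !mxE.
  by apply: (os_norm_mxsub hN); exact: lshift_inj.
- apply: le_lt_trans Ut; have -> : d = mxsub (@rshift n n) (@rshift n n) U.
    by apply/matrixP => i j; rewrite !mxE.
  by apply: (os_norm_mxsub hN); exact: rshift_inj.
Qed.

End BlockCharacterization.

(** * Complete boundedness of continuous maps into [M_k] *)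

Section MatrixValuedMaps.
Context {R : realType} {V : lmodType R[i]}.
Local Notation C := R[i].

Lemma sum_mxtens (U : nmodType) m n (F : 'I_(m * n) -> U) :
  \sum_p F p = \sum_i \sum_j F (mxtens_index (i, j)).
Proof.
rewrite pair_big (reindex (@mxtens_index m n)) /=; last first.
  by exists (@mxtens_unindex m n) => p _; rewrite ?mxtens_indexK ?mxtens_unindexK.
by apply: eq_bigr => -[].
Qed.

Lemma mxflatE k n (x : 'M['M[C]_k]_n) r s a c :
  mxflat x (mxtens_index (r, a)) (mxtens_index (s, c)) = x r s a c.
Proof. by rewrite mxE !mxtens_indexK. Qed.

Lemma mxflat_map_scale k n (f g : V -> 'M[C]_k) c (v : 'M[V]_n) :
  (forall x, g x = c *: f x) -> mxflat (map_mx g v) = c *: mxflat (map_mx f v).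
Proof. by move=> fg; apply/matrixP => i j; rewrite !mxE fg mxE. Qed.

Lemma opnormZ_le m n c (A : 'M[C]_(m, n)) : opnorm (c *: A) <= normc c * opnorm A.
Proof.
apply: opnorm_le => [|x]; first by rewrite mulr_ge0 ?normc_ge0 ?opnorm_ge0.
by rewrite -scalemxAl l2normZ -mulrA ler_wpM2l ?normc_ge0 ?l2norm_mul.
Qed.

Variables (N : matnorm V) (hN : operator_space N).

Lemma row_frob_le n k (y : 'cV[C]_(n * k)) (a : 'I_k) :
  frob (\row_(r < n) y (mxtens_index (r, a)) 0) <= l2norm y.
Proof.
rewrite /frob /l2norm ler_sqrt ?sum_normc2_ge0 // big_ord1 sum_mxtens.
apply: ler_sum => r _; rewrite mxE (bigD1 a) //= lerDl.
by apply: sumr_ge0 => c _; exact: sqr_ge0.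
Qed.

Lemma col_frob_le n k (x : 'cV[C]_(n * k)) (a : 'I_k) :
  frob (\col_(r < n) x (mxtens_index (r, a)) 0) <= l2norm x.
Proof.
rewrite /frob /l2norm ler_sqrt ?sum_normc2_ge0 // sum_mxtens.
apply: ler_sum => r _; rewrite big_ord1 mxE (bigD1 a) //= lerDl.
by apply: sumr_ge0 => c _; exact: sqr_ge0.
Qed.

(* Each entry of [phi] is a bounded functional, and a functional [f] is completely
   bounded because [y^T f_n(v) x = f (y^T v x)]. *)
Lemma Mnorm_map_le k (phi : {linear V -> 'M[C]_k}) b n (v : 'M[V]_n) : 0 <= b ->
  (forall x i j, normc (phi x i j) <= b * N (const_mx x : 'M_1)) ->
  Mnorm (map_mx phi v) <= (k%:R ^+ 2 * b) * N v.
Proof.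
move=> b0 phib; rewrite /Mnorm.
have kb0 : 0 <= k%:R ^+ 2 * b * N v by rewrite !mulr_ge0 ?exprn_ge0 ?os_norm_ge0.
apply: opnorm_le_dot => // x y.
(* Splitting [y] and [x] by their inner index leaves [k^2] terms, one for each entry [(a, c)] of
   [phi]; hence the factor [k^2]. *)
pose ya (a : 'I_k) := \row_(r < n) y (mxtens_index (r, a)) 0.
pose xc (c : 'I_k) := \col_(s < n) x (mxtens_index (s, c)) 0.
have -> : (y^T *m mxflat (map_mx phi v) *m x) 0 0 =
    \sum_c \sum_a phi (vconj (ya a) v (xc c) 0 0) a c.
  rewrite mxE sum_mxtens exchange_big; apply: eq_bigr => c _ /=.
  under eq_bigr => s _.
    rewrite mxE mulr_suml sum_mxtens.
    over.
  rewrite exchange_big /=.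
  under eq_bigr do rewrite exchange_big /=.
  rewrite exchange_big /=; apply: eq_bigr => a _.
  rewrite mxE linear_sum summxE; apply: eq_bigr => r _.
  rewrite linear_sum summxE; apply: eq_bigr => s _.
  by rewrite linearZ !mxE !mxtens_indexK /= mulrAC.
have bnd a c : normc (phi (vconj (ya a) v (xc c) 0 0) a c) <=
    b * N v * l2norm y * l2norm x.
  apply: le_trans (phib _ _ _) _; rewrite -!mulrA ler_wpM2l //.
  have -> : const_mx (vconj (ya a) v (xc c) 0 0) = vconj (ya a) v (xc c).
    by apply/matrixP => i j; rewrite !ord1 [LHS]mxE.
  apply: le_trans (os_conj hN _ _ _) _; rewrite mulrCA mulrA.
  rewrite ler_pM ?mulr_ge0 ?opnorm_ge0 ?os_norm_ge0 //; last first.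
    exact: le_trans (opnorm_le_frob _) (col_frob_le _ _).
  rewrite ler_wpM2r ?os_norm_ge0 //.
  exact: le_trans (opnorm_le_frob _) (row_frob_le _ _).
apply: le_trans (normc_sum _ _ _) _.
apply: (@le_trans _ _ (\sum_(c < k) \sum_(a < k) b * N v * l2norm y * l2norm x)).
  apply: ler_sum => c _; apply: le_trans (normc_sum _ _ _) _.
  by apply: ler_sum => a _; exact: bnd.
by rewrite !sumr_const !card_ord -mulrnA -[leLHS]mulr_natl natrM -expr2 !mulrA.
Qed.

(** Continuity at 0 with tolerance 1 yields a radius [d]; by homogeneity, [d^-1] bounds every
    entry. *)
Lemma mcontinuous_entry k (phi : {linear V -> 'M[C]_k}) :
  mcontinuous N (@Mnorm R k) phi ->
  exists2 b, 0 <= b & forall x i j, normc (phi x i j) <= b * N (const_mx x : 'M_1).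
Proof.
move=> /(_ 0 1 ltr01)[d d0 phid]; exists d^-1; first by rewrite invr_ge0 ltW.
move=> x i j; rewrite -ler_pdivrMl ?invr_gt0 // invrK.
(* The slack [e] makes [t] positive, even for [x] of norm zero, and keeps the norm of [(d / t) x]
   strictly below [d]. *)
apply/ler_addgt0Pr => e e0; set t := _ + e.
have t0 : 0 < t by rewrite ltr_wpDl ?os_norm_ge0.
pose c := ((d / t)%:C)%C.
have c0 : 0 <= d / t by rewrite divr_ge0 ?ltW.
have := phid (c *: x); rewrite subr0 linear0 subr0.
have -> : const_mx (c *: x) = vscale c (const_mx x : 'M_1).
  by apply/matrixP => a a'; rewrite !mxE.
rewrite (os_scale hN) normc_real // -mulrA -[ltRHS]mulr1 ltr_pM2l //.
rewrite mulrC ltr_pdivrMr // mul1r ltrDl => /(_ e0) h.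
have := le_lt_trans (opnorm_entry _ (mxtens_index (0, i)) (mxtens_index (0, j))) h.
rewrite mxflatE mxE linearZ mxE normcM normc_real // => /ltW.
by rewrite mulrAC ler_pdivrMr // mul1r.
Qed.

Lemma ccp_scale (P : matcone V) k (phi : {linear V -> 'M[C]_k}) :
  mcontinuous N (@Mnorm R k) phi -> cp P (@Mcone R k) phi ->
  exists2 c : R, 0 < c & ccp N P (@Mnorm R k) (@Mcone R k) ((c%:C)%C \*: phi).
Proof.
move=> /mcontinuous_entry[b b0 phib] phi_cp.
pose M := k%:R ^+ 2 * b; have M0 : 0 <= M by rewrite mulr_ge0 ?exprn_ge0.
have [c c0 cM] : exists2 c : R, 0 < c & c * M <= 1.
  (* The summand 1 guards against [M = 0]. *)
  exists (1 + M)^-1; first by rewrite invr_gt0 ltr_wpDr.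
  by rewrite mulrC ler_pdivrMr ?ltr_wpDr // mul1r lerDr.
have flatZ n (v : 'M[V]_n) :
    mxflat (map_mx ((c%:C)%C \*: phi) v) = (c%:C)%C *: mxflat (map_mx phi v).
  exact: mxflat_map_scale.
exists c; first exact: c0.
split=> n v.
  by move=> /phi_cp; rewrite /Mcone /= flatZ; apply: psdmxZ; exact: ltW.
rewrite /Mnorm flatZ; apply: le_trans (opnormZ_le _ _) _.
rewrite (normc_real (ltW c0)).
apply: le_trans (ler_wpM2l (ltW c0) (Mnorm_map_le v b0 phib)) _.
by rewrite mulrA ler_piMl ?os_norm_ge0.
Qed.

End MatrixValuedMaps.

(** * Homogeneity of [tmap] in its two maps *)

Section TensorScale.
Context {R : realType} {V W : lmodType R[i]}.
Local Notation C := R[i].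

Lemma tmap_scale k l (phi : {linear V -> 'M[C]_k}) (psi : {linear W -> 'M[C]_l}) c d x :
  tmap (c \*: phi) (d \*: psi) x = (c * d) *: tmap phi psi x.
Proof.
rewrite [x]tens_reprE; elim/big_rec: _ => [|p y _ IH]; first by rewrite !linear0.
rewrite [LHS]linearD [tmap phi psi _]linearD scalerDr -IH; congr (_ + _).
by rewrite /= !tmap_tens; apply/matrixP => i j; rewrite !mxE mulrACA.
Qed.

End TensorScale.

(** * Comparison with the Delta and delta structures *)

Section TensorNorms.
Context {R : realType} {V W : lmodType R[i]}.
Local Notation C := R[i].
Variables (sV : V -> V) (NV : matnorm V) (PV : matcone V).
Variables (sW : W -> W) (NW : matnorm W) (PW : matcone W).
Variables (Na : matnorm (V ⊗ W)%type) (Pa : matcone (V ⊗ W)%type).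
Hypothesis hV : operator_space NV.
Hypothesis hW : operator_space NW.
Hypothesis ha : matrix_regular (tens_star sV sW) Na Pa.

Section Delta.
Hypothesis subcross : forall k l (v : 'M[V]_k) (w : 'M[W]_l),
  Na (vtens v w) <= NV v * NW w.
Hypothesis cone_tens : forall k l (v : 'M[V]_k) (w : 'M[W]_l),
  PV v -> PW w -> Pa (vtens v w).

Lemma Delta_pos_sub n : Delta_pos PV PW (n := n) `<=` @Pa n.
Proof.
move=> z [k [l [alpha [v [w [Pv Pw ->]]]]]].
exact: (mo_congr (moos_mo (mr_moos ha)) alpha (cone_tens Pv Pw)).
Qed.

(** By [os_conj] and the subcross bound, every representation costs at least [Na z]; without
    representations the infimum is [+oo]. *)
Lemma norm_le_Delta_nu n (z : 'M[V ⊗ W]_n) : ((Na z)%:E <= Delta_nu NV PV NW PW z)%E.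
Proof.
apply: le_ereal_inf_tmp => _ [k [l [alpha [v [w [[_ _ ->] ->]]]]]].
rewrite lee_fin; apply: le_trans (os_conj (moos_os (mr_moos ha)) _ _ _) _.
rewrite opnorm_adj mulrAC -expr2 -mulrA ler_wpM2l ?sqr_ge0 //.
Qed.

Lemma norm_le_Delta n (z : 'M[V ⊗ W]_n) :
  ((Na z)%:E <= Delta_norm sV NV PV sW NW PW z)%E.
Proof.
apply: le_ereal_inf_tmp => _ [u [u' [/Delta_pos_sub/(norm_le_block ha) zu ->]]].
apply: (@le_trans _ _ (maxe (Na u)%:E (Na u')%:E)).
  by rewrite -EFin_max lee_fin.
by rewrite ge_max !le_max !norm_le_Delta_nu orbT.
Qed.

(** Approximation in [Delta_norm] is approximation in the smaller norm [Na], for which [Pa] is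
    closed. *)
Lemma Delta_cone_sub n : Delta_cone sV NV PV sW NW PW (n := n) `<=` @Pa n.
Proof.
move=> z zcl; apply: (moos_closed (mr_moos ha)) => e e0.
have [y /Delta_pos_sub Py ye] := zcl e e0; exists y => //.
exact: le_lt_trans (norm_le_Delta _) ye.
Qed.

End Delta.

Section delta.
Hypothesis tmap_ccp : forall k l (phi : {linear V -> 'M[C]_k})
    (psi : {linear W -> 'M[C]_l}),
  ccp NV PV (@Mnorm R k) (@Mcone R k) phi ->
  ccp NW PW (@Mnorm R l) (@Mcone R l) psi ->
  ccp Na Pa (@Mnorm R (k * l)) (@Mcone R (k * l)) (tmap phi psi).

(** The cone is tested on continuous c.p. maps, the hypothesis concerns c.c.p. ones: rescale by [c]
    and [d], then divide the positive matrix by [c d]. *)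
Lemma sub_delta_pos n : @Pa n `<=` delta_pos NV PV NW PW (n := n).
Proof.
move=> z Pz k l phi psi phi_cont phi_cp psi_cont psi_cp.
have [c c0 phi_ccp] := ccp_scale hV phi_cont phi_cp.
have [d d0 psi_ccp] := ccp_scale hW psi_cont psi_cp.
have [/(_ _ _ Pz) + _] := tmap_ccp phi_ccp psi_ccp; rewrite /Mcone /=.
rewrite (mxflat_map_scale _ (tmap_scale phi psi _ _)) -rmorphM /=.
have cd0 : 0 < c * d by rewrite mulr_gt0.
move=> /(@psdmxZ _ _ (c * d)^-1); rewrite invr_ge0 ltW // => /(_ isT).
by rewrite scalerA -rmorphM /= mulVf ?scale1r ?gt_eqF.
Qed.

Lemma delta_nu_le n (z : 'M[V ⊗ W]_n) : (delta_nu NV PV NW PW z <= (Na z)%:E)%E.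
Proof.
apply: ge_ereal_sup => _ [k [l [phi [psi [phi_ccp psi_ccp ->]]]]].
by rewrite lee_fin; have [_] := tmap_ccp phi_ccp psi_ccp; exact.
Qed.

(** A positive block for [Pa] with corners of norm below [Na z + e] is admissible in the infimum for
    delta, and [delta_nu] of each corner is at most its norm. *)
Lemma delta_norm_le n (z : 'M[V ⊗ W]_n) :
  (delta_norm sV NV PV sW NW PW z <= (Na z)%:E)%E.
Proof.
apply/lee_addgt0Pr => e e0.
have [|u [u' [Pu ue u'e]]] := block_of_norm_lt ha (z := z) (t := Na z + e).
  by rewrite ltrDl.
apply: ge_ereal_inf; exists (maxe (delta_nu NV PV NW PW u) (delta_nu NV PV NW PW u')).
  by exists u, u'; split => //; exact: sub_delta_pos.
by rewrite ge_max; apply/andP; split; apply: le_trans (delta_nu_le _) _;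
  rewrite -EFinD lee_fin ltW.
Qed.

(** Each [z] approximates itself, once [delta_norm] of 0 is known to be at most [Na 0 = 0]. *)
Lemma sub_delta_cone n : @Pa n `<=` delta_cone sV NV PV sW NW PW (n := n).
Proof.
move=> z Pz e e0; exists z; first exact: sub_delta_pos.
rewrite subrr; apply: le_lt_trans (delta_norm_le _) _.
by rewrite (os_norm0 (moos_os (mr_moos ha))) lte_fin.
Qed.

End delta.
End TensorNorms.

Theorem theorem3p9 (R : realType) (V W : lmodType R[i])
    (sV : V -> V) (NV : matnorm V) (PV : matcone V)
    (sW : W -> W) (NW : matnorm W) (PW : matcone W)
    (hV : matrix_regular sV NV PV) (hW : matrix_regular sW NW PW)
    (Na : matnorm (V ⊗ W)%type) (Pa : matcone (V ⊗ W)%type)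
    (ha : matrix_regular (tens_star sV sW) Na Pa) :
  ((forall k l (v : 'M[V]_k) (w : 'M[W]_l),
      Na (k * l)%N (vtens v w) <= NV k v * NW l w) ->
   (forall k l (v : 'M[V]_k) (w : 'M[W]_l),
      PV k v -> PW l w -> Pa (k * l)%N (vtens v w)) ->
   forall n,
     Delta_cone sV NV PV sW NW PW (n := n) `<=` Pa n /\
     forall z : 'M[V ⊗ W]_n,
       ((Na n z)%:E <= Delta_norm sV NV PV sW NW PW z)%E) /\
  ((forall k l (phi : {linear V -> 'M[R[i]]_k}) (psi : {linear W -> 'M[R[i]]_l}),
      ccp NV PV (@Mnorm R k) (@Mcone R k) phi ->
      ccp NW PW (@Mnorm R l) (@Mcone R l) psi ->
      ccp Na Pa (@Mnorm R (k * l)) (@Mcone R (k * l)) (tmap phi psi)) ->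
   forall n,
     Pa n `<=` delta_cone sV NV PV sW NW PW (n := n) /\
     forall z : 'M[V ⊗ W]_n,
       (delta_norm sV NV PV sW NW PW z <= (Na n z)%:E)%E).
Proof.
have oV := moos_os (mr_moos hV); have oW := moos_os (mr_moos hW).
split=> [subcross cone_tens|tmap_ccp] n; split.
- exact: (Delta_cone_sub ha subcross cone_tens).
- exact: (norm_le_Delta ha subcross cone_tens).
- exact: (sub_delta_cone oV oW ha tmap_ccp).
- exact: (delta_norm_le oV oW ha tmap_ccp).
Qed.
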